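(* Let $T_1,\dots,T_n$ be doubly commuting c.n.u. contractions acting on a Hilbert space $\mathcal H$. Then there corresponds a decomposition of $\mathcal H$ into an orthogonal sum of $2^n$ subspaces $\mathcal H_1,\dots,\mathcal H_{2^n}$ of $\mathcal H$ such that: (1) each $\mathcal H_j$, $1\le j\le 2^n$, is a joint reducing subspace for $T_1,\dots,T_n$; (2) $T_i|_{\mathcal H_j}$ is either a pure isometry or a c.n.i. contraction for all $i=1,\dots,n$ and $j=1,\dots,2^n$; (3) if $\mathcal F_n=\{(\mathcal A_j,\mathcal H_j):1\le j\le 2^n\}$, where $\mathcal A_j=(T_1|_{\mathcal H_j},\dots,T_n|_{\mathcal H_j})$ for each $j$, and if $\mathcal M_n$ is the set of all functions $f:\{1,\dots,n\}\to\{B1,B2\}$, then corresponding to every $g\in\mathcal M_n$ there exists a unique element $(\mathcal A_g,\mathcal H_g)\in\mathcal F_n$ such that the $k$-th component of $\mathcal A_g$ is of type $g(k)$, for $1\le k\le n$; (4) $\mathcal H_1$ is the maximal joint reducing subspace for $T_1,\dots,T_n$ such that $T_1|_{\mathcal H_1},\dots,T_n|_{\mathcal H_1}$ are pure isometries; (5) $\mathcal H_{2^n}$ is the maximal joint reducing subspace for $T_1,\dots,T_n$ such that $T_1|_{\mathcal H_{2^n}},\dots,T_n|_{\mathcal H_{2^n}}$ are c.n.i. contractions. One or more members of $\{\mathcal H_j:j=1,\dots,2^n\}$ may coincide with the trivial subspace $\{0\}$.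
   Context: Operators are bounded linear operators on complex Hilbert spaces; a contraction is an operator of norm at most $1$. Commuting contractions $T_1,\dots,T_n$ are doubly commuting if $T_iT_j^*=T_j^*T_i$ for all $i\neq j$. A contraction $T$ is completely non-unitary (c.n.u.), respectively completely non-isometry (c.n.i.), if no nonzero closed subspace reduces $T$ to a unitary, respectively to an isometry. A pure isometry (unilateral shift) is an isometry $V$ with $V^{*m}h\to0$ as $m\to\infty$ for every $h$. A contraction is of type $B1$ if it is a pure isometry and of type $B2$ if it is a c.n.i. contraction. Elements of $\mathcal F_n$ are counted with their index $j$ (so there are $2^n$ of them), each carrying an assigned list of types for its components, also when $\mathcal H_j=\{0\}$. *)

(* Defs.v *)
From mathcomp Require Import all_boot all_order all_algebra.
From mathcomp Require Import all_classical all_reals all_analysis.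
From mathcomp Require Import complex.
Import Order.TTheory GRing.Theory Num.Theory.
Import numFieldNormedType.Exports.

Set Implicit Arguments.
Unset Strict Implicit.
Unset Printing Implicit Defensive.

Local Open Scope classical_set_scope.
Local Open Scope ring_scope.
Local Open Scope complex_scope.

(* A complex Hilbert space is a complete normed space H over R[i] together with
   a positive definite Hermitian form dot (linear in its first argument) that
   induces the norm of H. *)
Definition hilbert (R : realType) (H : completeNormedModType R[i])
    (dot : {dot H for Num.conj}) : Prop :=
  forall x : H, dot x x = `|x| ^+ 2.

(* An operator on a closed subspace M is represented by a map T : H -> H sending
   M into M; only the values of T on M matter, so the restriction of T to M is
   the pair (M, T). The predicates below with parameter M are about this
   restriction, viewed as an operator on the Hilbert space M; operators on the
   whole space are the case M = setT. *)
Section Operators.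
Variables (R : realType) (H : completeNormedModType R[i]).
Variable dot : {dot H for Num.conj}.
Implicit Types (M L : set H) (T : H -> H).

Definition closed_subspace M : Prop :=
  [/\ M 0,
      forall (a : R[i]) (x y : H), M x -> M y -> M (a *: x + y)
    & closed M].

(* The adjoint of T|_M computed inside M: it sends y to the z in M such that
   <T x, y> = <x, z> for all x in M. Such a z is unique when M is a subspace,
   and exists (Riesz) when M is a closed subspace and T|_M is bounded. *)
Definition adjoint_on M T : H -> H := fun y =>
  xget 0 [set z | M z /\ forall x, M x -> dot (T x) y = dot x z].

Definition reduces M T L : Prop :=
  [/\ closed_subspace L,
      L `<=` M,
      (forall x, L x -> L (T x))
    & (forall x, L x -> L (adjoint_on M T x))].

Definition contraction_on M T : Prop := forall x, M x -> `|T x| <= `|x|.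

Definition isometry_on M T : Prop := forall x, M x -> `|T x| = `|x|.

Definition unitary_on M T : Prop := isometry_on M T /\ T @` M = M.

Definition cnu_contraction_on M T : Prop :=
  contraction_on M T /\
  forall L, reduces M T L -> unitary_on L T -> L = [set 0].

Definition cni_contraction_on M T : Prop :=
  contraction_on M T /\
  forall L, reduces M T L -> isometry_on L T -> L = [set 0].

Definition pure_isometry_on M T : Prop :=
  isometry_on M T /\
  forall h, M h -> (iter m (adjoint_on M T) h @[m --> \oo] --> (0 : H)).

Definition doubly_commuting n (T : 'I_n -> {linear H -> H}) : Prop :=
  (forall i j x, T i (T j x) = T j (T i x)) /\
  (forall i j, i != j -> forall x,
     T i (adjoint_on setT (T j) x) = adjoint_on setT (T j) (T i x)).

Definition joint_reducing n (T : 'I_n -> {linear H -> H}) L : Prop :=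
  closed_subspace L /\ forall i, reduces setT (T i) L.

(* L is the largest joint reducing subspace on which every T i satisfies P. *)
Definition maximal_joint_reducing n (T : 'I_n -> {linear H -> H})
    (P : set H -> (H -> H) -> Prop) L : Prop :=
  [/\ joint_reducing T L,
      forall i, P L (T i)
    & forall K, joint_reducing T K -> (forall i, P K (T i)) -> K `<=` L].

Definition orthogonal_sum N (Hs : 'I_N -> set H) : Prop :=
  [/\ forall j, closed_subspace (Hs j),
      forall j k, j != k -> forall x y, Hs j x -> Hs k y -> dot x y = 0
    & forall x, exists y : 'I_N -> H,
        (forall j, Hs j (y j)) /\ x = \sum_(j < N) y j].

End Operators.

Inductive btype := B1 | B2.

Definition of_type (R : realType) (H : completeNormedModType R[i])
    (dot : {dot H for Num.conj}) (t : btype) (M : set H) (T : H -> H) : Prop :=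
  match t with
  | B1 => pure_isometry_on dot M T
  | B2 => cni_contraction_on dot M T
  end.

Fact pow2_gt0 n : (0 < 2 ^ n)%N. Proof. by rewrite expn_gt0. Qed.

Fact pow2_pred_lt n : ((2 ^ n).-1 < 2 ^ n)%N.
Proof. by rewrite prednK ?pow2_gt0. Qed.

(* The indices 1, ..., 2^n are shifted to 0, ..., 2^n - 1. *)
Definition first_index n : 'I_(2 ^ n) := Ordinal (pow2_gt0 n).
Definition last_index n : 'I_(2 ^ n) := Ordinal (pow2_pred_lt n).

(* Main.v *)
(* Let T_i^* be the adjoint and M_i the set of vectors x such that
   T_i^* T_i w x = w x for every word w in T_i and T_i^*. It is the largest
   subspace reducing T_i to an isometry, and every operator commuting with T_i
   and T_i^* preserves it; by double commutation M_i reduces every T_k, and the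
   orthogonal projections onto M_1, ..., M_n preserve each M_k and each
   orthogonal complement of M_k. Hence H is the orthogonal sum of the 2^n
   intersections obtained by choosing, for each i, either M_i (type B1) or its
   complement (type B2). On M_i the operator is a pure isometry: the vectors
   orthogonal to those killed asymptotically by the powers of T_i^* form a
   reducing subspace on which T_i is unitary, which is zero since T_i is c.n.u.
   The complement of M_i contains no part on which T_i is isometric. *)

Require Import Defs.
From HB Require Import structures.
From mathcomp Require Import all_boot all_order all_algebra.
From mathcomp Require Import all_classical all_reals all_analysis.
From mathcomp Require Import complex ring.
Import Order.TTheory GRing.Theory Num.Theory.
Import numFieldNormedType.Exports.

Local Open Scope classical_set_scope.
Local Open Scope ring_scope.
Local Open Scope complex_scope.

(** * Binary digits of the indices below [2 ^ n] *)

Definition bit (i j : nat) : bool := odd (j %/ 2 ^ i).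

Lemma bit0n i : bit i 0 = false.
Proof. by rewrite /bit div0n. Qed.

Lemma bit0 j : bit 0 j = odd j.
Proof. by rewrite /bit expn0 divn1. Qed.

Lemma bitS i j : bit i.+1 j = bit i j./2.
Proof. by rewrite /bit expnS divnMA divn2. Qed.

Lemma bit_inj n a b : (a < 2 ^ n)%N -> (b < 2 ^ n)%N ->
  (forall i, (i < n)%N -> bit i a = bit i b) -> a = b.
Proof.
elim: n a b => [|n IH] a b.
  by rewrite expn0 !ltnS !leqn0 => /eqP -> /eqP ->.
rewrite expnS mul2n => an bn ab.
rewrite -[a]odd_double_half -[b]odd_double_half -!bit0 ab//.
congr (_ + _.*2)%N; apply: IH.
- by rewrite ltn_half_double.
- by rewrite ltn_half_double.
- by move=> i ilt; rewrite -!bitS ab.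
Qed.

(** Dividing by [2 ^ i] turns the summand [2 ^ k] into [2 ^ (k - i)], which is even because
    [i < k]. *)
Lemma bit_pow2D k i j : (i < k)%N -> bit i (2 ^ k + j) = bit i j.
Proof.
move=> ik; rewrite /bit -{1}(subnK (ltnW ik)) expnD divnMDl ?expn_gt0//.
by rewrite oddD oddX subn_eq0 leqNgt ik.
Qed.

Lemma bit_pow2D_diag k j : (j < 2 ^ k)%N -> bit k (2 ^ k + j).
Proof.
by move=> jk; rewrite /bit -{1}[(2 ^ k)%N]mul1n divnMDl ?expn_gt0// divn_small.
Qed.

Lemma bit_diag k j : (j < 2 ^ k)%N -> bit k j = false.
Proof. by move=> jk; rewrite /bit divn_small. Qed.

Lemma bit_pow2_pred n i : (i < n)%N -> bit i (2 ^ n).-1.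
Proof.
elim: n => // n IH; rewrite ltnS leq_eqVlt expnS mul2n -addnn.
rewrite -subn1 -addnBA ?expn_gt0// subn1 => /predU1P[->|ilt].
  by rewrite bit_pow2D_diag// pow2_pred_lt.
by rewrite bit_pow2D// IH.
Qed.

Lemma ord_bit_inj n (a b : 'I_(2 ^ n)) :
  (forall i : 'I_n, bit i a = bit i b) -> a = b.
Proof.
move=> ab; apply: val_inj; apply: (bit_inj n); rewrite ?ltn_ord// => i ilt.
exact: (ab (Ordinal ilt)).
Qed.

(** Reading off digits is an injective map between two finite sets with [2 ^ n] elements, hence a
    bijection. *)
Lemma bit_surj n (g : 'I_n -> bool) :
  exists j : 'I_(2 ^ n), forall i : 'I_n, bit i j = g i.
Proof.
pose F (j : 'I_(2 ^ n)) := [ffun i : 'I_n => bit i j].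
have Finj : injective F.
  by move=> a b /ffunP ab; apply: ord_bit_inj => i; have := ab i; rewrite !ffunE.
have [|G _ GK] := inj_card_bij Finj.
  by rewrite card_ffun card_bool !card_ord.
by exists (G (finfun g)) => i; have /ffunP/(_ i) := GK (finfun g); rewrite !ffunE.
Qed.

(** * Inner product, norm and closed sets *)

Section Hilbert.
Context {R : realType} {H : completeNormedModType R[i]}.
Context {dot : {dot H for Num.conj}} (Hdot : hilbert dot).
Implicit Types (x y z : H) (a : R[i]) (M L : set H).

Lemma dotDl x y z : dot (x + y) z = dot x z + dot y z.
Proof. exact: linearDl. Qed.

Lemma dotBl x y z : dot (x - y) z = dot x z - dot y z.
Proof. exact: linearBl. Qed.

Lemma dotBr x y z : dot x (y - z) = dot x y - dot x z.
Proof. exact: linearBr. Qed.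

Lemma dotZl a x y : dot (a *: x) y = a * dot x y.
Proof. exact: linearZl_LR. Qed.

Lemma dotZr a x y : dot x (a *: y) = Num.conj a * dot x y.
Proof. exact: linearZr_LR. Qed.

Lemma dot0r x : dot x 0 = 0.
Proof. exact: linear0r. Qed.

Lemma dot0l x : dot 0 x = 0.
Proof. exact: linear0l. Qed.

Lemma dotC x y : dot x y = Num.conj (dot y x).
Proof. by rewrite hermC expr0 mul1r. Qed.

Lemma dot0C x y : dot x y = 0 -> dot y x = 0.
Proof. by move=> xy; rewrite dotC xy conjC0. Qed.

Lemma dot_injr y z : (forall x, dot x y = dot x z) -> y = z.
Proof.
move=> yz; apply/eqP; rewrite -subr_eq0 -(dnorm_eq0 dot) dotBr.
by rewrite yz subrr.
Qed.

(** Pythagoras for the projection of [x] onto the line of [y]; it yields both Cauchy-Schwarz and the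
    orthogonality of near minimizers. *)
Lemma sqr_norm_sub_proj x y : y != 0 ->
  `|x - (dot x y / dot y y) *: y| ^+ 2 =
  `|x| ^+ 2 - `|dot x y| ^+ 2 / `|y| ^+ 2.
Proof.
move=> y0; rewrite -!Hdot; set d := dot y y.
have d0 : d != 0 by rewrite dnorm_eq0.
have dr : Num.conj d = d by rewrite -dotC.
rewrite dnormB dnormZ dotZr -/d rmorphM rmorphV ?unitfE//= dr.
set c := dot x y; rewrite normrM exprMn normrV ?unitfE// exprVn.
rewrite (ger0_norm (dnorm_ge0 _ _)) -/d.
have -> : Num.conj c / d * c = `|c| ^+ 2 / d by rewrite normCK mulrAC (mulrC c).
rewrite rmorphM rmorphXn /= rmorphV ?unitfE//= dr conj_normC.
by field.
Qed.

Lemma cauchy_schwarz x y : `|dot x y| <= `|x| * `|y|.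
Proof.
have [->|y0] := eqVneq y 0; first by rewrite dot0r !normr0 mulr0.
rewrite -(@ler_pXn2r _ 2)// ?nnegrE ?mulr_ge0// exprMn.
rewrite -ler_pdivrMr ?exprn_gt0 ?normr_gt0// -subr_ge0.
by rewrite -sqr_norm_sub_proj// exprn_ge0.
Qed.

Lemma parallelogram x y :
  `|x + y| ^+ 2 + `|x - y| ^+ 2 = 2 * (`|x| ^+ 2 + `|y| ^+ 2).
Proof. by rewrite -!Hdot dnormD dnormB; ring. Qed.

Lemma closedP_dist (A : set H) :
  (forall x, (forall e : R[i], 0 < e -> exists2 y, A y & `|x - y| < e) -> A x) ->
  closed A.
Proof.
move=> Acl x Ax; apply: Acl => e e0.
have [y [Ay yx]] := Ax _ (nbhsx_ballx x e e0).
by exists y => //; move: yx; rewrite -ball_normE.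
Qed.

Lemma closed_dist (A : set H) x : closed A ->
  (forall e : R[i], 0 < e -> exists2 y, A y & `|x - y| < e) -> A x.
Proof.
move=> Acl Ax; apply: Acl => B /nbhs_ballP[e /= e0 eB].
have [y Ay xy] := Ax e e0.
by exists y; split => //; apply: eB; rewrite -ball_normE.
Qed.

Lemma closed_dot_eq0 z : closed [set x | dot x z = 0].
Proof.
apply: closedP_dist => x xz /=.
have [->|z0] := eqVneq z 0; first by rewrite dot0r.
have [//|] := eqVneq (dot x z) 0; rewrite -normr_gt0 => d0.
(* With this radius, Cauchy-Schwarz for [x - y] gives [|<x, z>| < |<x, z>|], since [<y, z> = 0]. *)
have [|y /= yz xy] := xz (`|dot x z| / `|z|); first by rewrite divr_gt0// normr_gt0.
have := cauchy_schwarz (x - y) z.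
rewrite dotBl yz subr0 => /le_lt_trans -/(_ (`|dot x z|)).
by rewrite -ltr_pdivlMr ?normr_gt0// ltxx => /(_ xy).
Qed.

(** Norms and tolerances live in [R[i]]; positive ones are real, so infima can be taken in [R]. *)
Lemma gt0_complexE (e : R[i]) : 0 < e -> exists2 r : R, 0 < r & e = r%:C.
Proof.
move=> e0; exists (complex.Re e); last by rewrite RRe_real// gtr0_real.
by rewrite -ltcR RRe_real// gtr0_real.
Qed.

Lemma near_infty_natSinv_ltC (e : R[i]) : 0 < e ->
  \forall k \near \oo, (k.+1%:R^-1 : R)%:C < e.
Proof.
move=> /gt0_complexE[r r0 ->].
have := near_infty_natSinv_lt (PosNum r0).
by apply: filterS => k /=; rewrite ltcR.
Qed.

Lemma sqr_norm_complexE x : exists r : R, `|x| ^+ 2 = r%:C.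
Proof.
by exists (complex.Re (`|x| ^+ 2)); rewrite RRe_real// rpredX// normr_real.
Qed.

Lemma cauchy_seq_cvgn (u : nat -> H) :
  (forall e : R[i], 0 < e -> exists k, \forall m \near \oo, `|u k - u m| < e) ->
  exists l : H, u m @[m --> \oo] --> l.
Proof.
move=> ucauchy; apply/cvg_ex; apply/cauchy_cvgP/cauchy_exP => e /ucauchy[k ku].
exists (u k); move: ku; apply: filterS => m /=.
by rewrite -ball_normE.
Qed.

Lemma closed_subspaceB {M x y} : closed_subspace M -> M x -> M y -> M (x - y).
Proof.
by case=> _ MP _ Mx My; rewrite addrC -scaleN1r; exact: MP.
Qed.

Lemma closed_subspaceZ {M a x} : closed_subspace M -> M x -> M (a *: x).
Proof. by case=> M0 MP _ Mx; rewrite -[_ *: _]addr0; exact: MP. Qed.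

(** * Orthogonal projection onto a closed subspace, by minimizing the distance *)

Definition near_minimizer M x (d : R) (e : R[i]) y :=
  M y /\ `|x - y| ^+ 2 < d%:C + e.

Section Projection.
Context {M : set H} (Mcl : closed_subspace M) (x : H).

Let D := [set r : R | exists2 y, M y & `|x - y| ^+ 2 = r%:C].
Let d := inf D.

Let has_infD : has_inf D.
Proof.
split; last first.
  by exists 0 => r [y _ yr]; rewrite -lecR -yr exprn_ge0.
have [r xr] := sqr_norm_complexE (x - 0).
by exists r; exists 0 => //; case: Mcl.
Qed.

Let d_le y : M y -> d%:C <= `|x - y| ^+ 2.
Proof.
move=> My; have [r yr] := sqr_norm_complexE (x - y).
rewrite yr lecR; apply: ge_inf; first by case: has_infD.
by exists y.
Qed.

Let minimizer_ex e : 0 < e -> exists y, near_minimizer M x d e y.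
Proof.
move=> /gt0_complexE[r r0 ->].
have [s [y My ys] sd] := inf_adherent r0 has_infD.
by exists y; split => //; rewrite ys -rmorphD ltcR.
Qed.

(** By the parallelogram law, [|y - z|^2] is [2 (|x - y|^2 + |x - z|^2)] minus four times the
    squared distance from [x] to the midpoint of [y] and [z]. The midpoint lies in [M], so that
    distance squared is at least [d]. *)
Let minimizer_dist e y z : near_minimizer M x d e y ->
  near_minimizer M x d e z -> `|y - z| ^+ 2 < 4 * e.
Proof.
move=> [My yd] [Mz zd].
have := parallelogram (x - y) (x - z).
have -> : x - y - (x - z) = z - y.
  by rewrite opprB addrC subrKA.
have -> : x - y + (x - z) = 2%:R *: (x - 2%:R^-1 *: (y + z)).
  rewrite scalerBr scalerA divff ?pnatr_eq0// scale1r scaler_nat mulr2n.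
  by rewrite opprD addrACA.
rewrite normrZ normr_nat exprMn (distrC z y) => pE.
have : d%:C <= `|x - 2%:R^-1 *: (y + z)| ^+ 2.
  apply: d_le; apply: closed_subspaceZ => //.
  by rewrite -[y]scale1r; have [_ + _] := Mcl; apply.
have -> : `|y - z| ^+ 2 = 2 * (`|x - y| ^+ 2 + `|x - z| ^+ 2)
   - 2%:R ^+ 2 * `|x - 2%:R^-1 *: (y + z)| ^+ 2.
  by rewrite -pE; ring.
move=> dw; rewrite ltrBlDr.
apply: (@lt_le_trans _ _ (4 * e + 4 * d%:C)); last first.
  by rewrite lerD2l -natrX ler_pM2l.
rewrite -mulrDr -[4]/((2 * 2)%N%:R) natrM -mulrA ltr_pM2l//.
by rewrite mulrDl mul1r (addrC e) ltrD.
Qed.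

(* Moving y along z decreases the squared distance by |<x - y, z>|^2 / |z|^2. *)
Let minimizer_dot e y z : near_minimizer M x d e y -> M z ->
  `|dot (x - y) z| ^+ 2 <= e * `|z| ^+ 2.
Proof.
move=> [My yd] Mz; have [->|z0] := eqVneq z 0.
  by rewrite dot0r !normr0 expr0n mulr0.
rewrite -ler_pdivrMr ?exprn_gt0 ?normr_gt0//.
have := sqr_norm_sub_proj (x - y) _ z0.
set a := _ / _; rewrite -addrA -opprD => yE.
have : d%:C <= `|x - (y + a *: z)| ^+ 2.
  by apply: d_le; rewrite addrC; have [_ + _] := Mcl; apply.
rewrite yE lerBrDr => dy.
by rewrite -(lerD2l d%:C) ltW// (le_lt_trans dy).
Qed.

Lemma orthogonal_projection_ex :
  exists y, M y /\ forall z, M z -> dot (x - y) z = 0.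
Proof.
have q0 k : 0 < (k.+1%:R^-1 : R)%:C by rewrite ltcR invr_gt0.
have /choice[u uP] k := minimizer_ex _ (q0 k).
have le_minimizer e e' y : e <= e' -> near_minimizer M x d e y ->
    near_minimizer M x d e' y.
  by move=> ee' [My ye]; split=> //; rewrite (lt_le_trans ye)// lerD2l.
have u_near e : 0 < e -> \forall k \near \oo, near_minimizer M x d e (u k).
  move=> /near_infty_natSinv_ltC; apply: filterS => k /ltW ke.
  exact: le_minimizer ke (uP k).
have [|l ul] := cauchy_seq_cvgn u.
  (* Tolerance [e ^+ 2 / 4] makes the bound of [minimizer_dist] equal to [e ^+ 2]. *)
  move=> e e0; have e4 : 0 < e ^+ 2 / 4 by rewrite divr_gt0// exprn_gt0.
  have /u_near [N _ uN] := e4.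
  exists N; exists N => // m /= Nm.
  rewrite -(@ltr_pXn2r _ 2)// ?nnegrE// ?(ltW e0)//.
  have := minimizer_dist _ _ _ (uN N (leqnn N)) (uN m Nm).
  by rewrite mulrC divfK// pnatr_eq0.
(* Instead of showing that [l] attains the infimum, orthogonality is transferred to [l] from near
   minimizers arbitrarily close to it. *)
have lP e1 e2 : 0 < e1 -> 0 < e2 ->
    exists2 y, near_minimizer M x d e2 y & `|l - y| < e1.
  move=> e10 e20; have /cvgrPdist_lt/(_ e1 e10) ule := ul.
  have [k [ky kl]] := filter_ex (filterI (u_near _ e20) ule).
  by exists (u k).
exists l; split.
  apply: closed_dist; first by case: Mcl.
  by move=> e e0; have [y [My _] yl] := lP e 1 e0 ltr01; exists y.
move=> z Mz; have [->|z0] := eqVneq z 0; first by rewrite dot0r.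
have [//|] := eqVneq (dot (x - l) z) 0; rewrite -normr_gt0 => c0.
set c := `|dot _ _| in c0.
(* This choice bounds both [|<x - y, z>|] and [|<y - l, z>|] by [c / 2], the second strictly, so
   their sum cannot reach [c]. *)
have e0 : 0 < c / 2 / `|z| by rewrite !divr_gt0// normr_gt0.
have [y yd yl] := lP _ _ e0 (exprn_gt0 2 e0).
have := minimizer_dot _ _ _ yd Mz.
rewrite -exprMn divfK ?normr_eq0//.
rewrite ler_pXn2r// ?nnegrE ?divr_ge0 ?(ltW c0)// => c1.
have c2 : `|dot (y - l) z| < c / 2.
  rewrite (le_lt_trans (cauchy_schwarz _ _))// distrC.
  by rewrite -ltr_pdivlMr// normr_gt0.
have : c < c / 2 + c / 2.
  rewrite {1}/c -(subrKA y x (- l)) dotDl (le_lt_trans (ler_normD _ _))//.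
  exact: ler_ltD.
by rewrite -splitr ltxx.
Qed.

End Projection.

(** * Closed subspaces and the Riesz representation theorem *)

Lemma closed_subspace_bigI {I} (D : set I) (L : I -> set H) :
  (forall i, D i -> closed_subspace (L i)) ->
  closed_subspace (\bigcap_(i in D) L i).
Proof.
move=> Lcl; split.
- by move=> i /Lcl[].
- move=> a x y xL yL i Di; have [_ + _] := Lcl i Di.
  by apply; [exact: xL|exact: yL].
- by apply: closed_bigI => i /Lcl[].
Qed.

Lemma closed_lipschitz_preimage (A : set H) (k : R[i]) (f : H -> H) :
  0 < k -> (forall x y, `|f x - f y| <= k * `|x - y|) ->
  closed A -> closed (f @^-1` A).
Proof.
move=> k0 fk Acl; apply: closedP_dist => x fx /=.
apply: closed_dist => // e e0; have [|y fy xy] := fx (e / k).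
  by rewrite divr_gt0.
by exists (f y) => //; rewrite (le_lt_trans (fk _ _))// mulrC -ltr_pdivlMr.
Qed.

(** Take [v] orthogonal to the kernel with [phi v] nonzero. Then [x - (phi x / phi v) *: v] is in
    the kernel, hence orthogonal to [v], which expresses [phi x] through [<x, v>]. *)
Lemma riesz (phi : H -> R[i]) :
  (forall a x y, phi (a *: x + y) = a * phi x + phi y) ->
  closed [set x | phi x = 0] ->
  exists z, forall x, phi x = dot x z.
Proof.
move=> phiP kercl.
have phi0 : phi 0 = 0.
  by have := phiP (-1) 0 0; rewrite scaler0 addr0 mulN1r addNr.
have phiZ a x : phi (a *: x) = a * phi x by rewrite -[a *: x]addr0 phiP phi0 addr0.
have kersub : closed_subspace [set x | phi x = 0].
  by split=> //= a x y px py; rewrite phiP px py mulr0 addr0.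
have [phi_eq0|/existsNP[x0 /eqP px0]] := pselect (forall x, phi x = 0).
  by exists 0 => x; rewrite dot0r phi_eq0.
have [y [/= py yP]] := orthogonal_projection_ex kersub x0.
set v := x0 - y; have pv : phi v = phi x0.
  by rewrite /v addrC -scaleN1r phiP py mulr0 add0r.
have v0 : dot v v != 0.
  rewrite dnorm_eq0; apply: contraNneq px0 => v0.
  by rewrite -pv v0 phi0.
have pv0 : phi v != 0 by rewrite pv.
(* The conjugate compensates for the conjugate linearity of [dot] in its second argument. *)
exists (Num.conj (phi v / dot v v) *: v) => x.
rewrite dotZr conjCK; have : dot (x - (phi x / phi v) *: v) v = 0.
  rewrite dotC yP ?conjC0//=.
  by rewrite addrC -scaleNr phiP mulNr divfK// addNr.
rewrite dotBl dotZl => /eqP; rewrite subr_eq0 => /eqP ->.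
by field; rewrite v0 pv0.
Qed.

(** * Orthogonal complements and projections *)

Definition orthocomp M : set H := [set x | forall z, M z -> dot x z = 0].

Lemma orthocomp_closed M : closed_subspace (orthocomp M).
Proof.
split=> [z _|a x y xM yM z Mz|]; first exact: dot0l.
  by rewrite dotDl dotZl xM// yM// mulr0 addr0.
rewrite (_ : orthocomp M = \bigcap_(z in M) [set x | dot x z = 0]).
  by apply: closed_bigI => z _; exact: closed_dot_eq0.
by apply/seteqP; split=> x xM z Mz; exact: xM.
Qed.

Lemma orthocomp_eq0 M x : M x -> orthocomp M x -> x = 0.
Proof. by move=> Mx /(_ _ Mx)/eqP; rewrite dnorm_eq0 => /eqP. Qed.

Definition proj M x : H := xget 0 [set y | M y /\ orthocomp M (x - y)].

Section ProjTheory.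
Context {M : set H} (Mcl : closed_subspace M).

Lemma projP x : M (proj M x) /\ orthocomp M (x - proj M x).
Proof. exact: (xgetPex 0 (orthogonal_projection_ex Mcl x)). Qed.

Lemma proj_mem x : M (proj M x).
Proof. by have [] := projP x. Qed.

Lemma proj_orthocomp x : orthocomp M (x - proj M x).
Proof. by have [] := projP x. Qed.

Lemma proj_unique x y : M y -> orthocomp M (x - y) -> proj M x = y.
Proof.
move=> My xy; have [Mp xp] := projP x; apply/eqP; rewrite -subr_eq0; apply/eqP.
apply: (orthocomp_eq0 M); first exact: closed_subspaceB.
rewrite (_ : _ - y = x - y - (x - proj M x)).
  exact: closed_subspaceB (orthocomp_closed M) xy xp.
by rewrite opprB [RHS]addrC subrKA.
Qed.

Lemma dot_projl x y : dot (proj M x) y = dot (proj M x) (proj M y).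
Proof.
apply/eqP; rewrite -subr_eq0 -dotBr dotC conjC_eq0.
by rewrite (proj_orthocomp y _ (proj_mem x)).
Qed.

Lemma dot_proj x y : dot (proj M x) y = dot x (proj M y).
Proof. by rewrite (dot_projl x) [RHS]dotC (dot_projl y) -dotC. Qed.

(** [f x - f (proj M x)] is [f] applied to a vector orthogonal to [M]; it stays orthogonal since the
    formal adjoint [g] preserves [M]. *)
Lemma proj_commute (f g : H -> H) x : {morph f : y z / y - z} ->
  (forall y, M y -> M (f y)) -> (forall y, M y -> M (g y)) ->
  (forall y z, dot (f y) z = dot y (g z)) -> proj M (f x) = f (proj M x).
Proof.
move=> fB Mf Mg fg; apply: proj_unique; first exact/Mf/proj_mem.
by move=> z Mz; rewrite -fB fg proj_orthocomp//; exact: Mg.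
Qed.

End ProjTheory.

(** * Adjoints of contractions and reducing subspaces *)

Local Notation adj T := (adjoint_on dot setT T).

Section Adjoint.
Context {T : {linear H -> H}} (Tc : contraction_on setT T).

Lemma adjointE x y : dot (T x) y = dot x (adj T y).
Proof.
suff : exists z, setT z /\ forall x, setT x -> dot (T x) y = dot x z.
  by move=> /(xgetPex 0)[_]; apply.
have [||z zP] := @riesz (fun x => dot (T x) y).
- by move=> a u v; rewrite linearP dotDl dotZl.
- apply: (closed_lipschitz_preimage _ 1) (closed_dot_eq0 y) => // u v.
  by rewrite -linearB mul1r; exact: Tc.
by exists z.
Qed.

Lemma adjointEr x y : dot (adj T x) y = dot x (T y).
Proof. by rewrite dotC -adjointE -dotC. Qed.

Lemma adjoint_linear a x y : adj T (a *: x + y) = a *: adj T x + adj T y.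
Proof.
apply: dot_injr => z; rewrite dotC [RHS]dotC; congr Num.conj.
by rewrite adjointEr !dotDl !dotZl !adjointEr.
Qed.

Lemma adjointB x y : adj T (x - y) = adj T x - adj T y.
Proof. by rewrite addrC -scaleN1r adjoint_linear scaleN1r addrC. Qed.

(** Cauchy-Schwarz bounds [|adj T x|^2 = <T (adj T x), x>] by [|adj T x| |x|]; then divide. *)
Lemma adjoint_contraction x : `|adj T x| <= `|x|.
Proof.
have [->|x0] := eqVneq (adj T x) 0; first by rewrite normr0.
have a0 : 0 < `|adj T x| by rewrite normr_gt0.
rewrite -(ler_pM2l a0) -expr2 -Hdot -adjointE -[leLHS]ger0_norm; last first.
  by rewrite adjointE dnorm_ge0.
by rewrite (le_trans (cauchy_schwarz _ _))// ler_wpM2r// Tc.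
Qed.

(** Expanding, [|adj T (T x) - x|^2 = |adj T (T x)|^2 - |x|^2], which is at most 0. The hypothesis
    concerns the single vector [x], so no polarization is involved. *)
Lemma isometric_adjointK x : `|T x| = `|x| -> adj T (T x) = x.
Proof.
move=> Tx; apply/eqP; rewrite -subr_eq0 -(dnorm_eq0 dot) eq_le dnorm_ge0 andbT.
rewrite dnormB (adjointEr _ x) !Hdot Tx conj_Creal ?rpredX ?normr_real//.
rewrite opprD addrA addrK subr_le0 ler_pXn2r ?nnegrE//.
by rewrite (le_trans (adjoint_contraction _))// Tx.
Qed.

(** Allows the predicates relative to a reducing subspace [K] to be handled with the adjoint on the
    whole space. *)
Lemma adjoint_onE {K : set H} y : closed_subspace K -> K y -> K (adj T y) ->
  adjoint_on dot K T y = adj T y.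
Proof.
move=> Kcl Ky Ky'.
have [|Kz zP] := xgetPex 0
    (P := [set z | K z /\ forall x, K x -> dot (T x) y = dot x z]).
  by exists (adj T y); split => // x _; rewrite adjointE.
apply/eqP; rewrite -subr_eq0 -(dnorm_eq0 dot) dotBr -zP ?adjointE ?subrr//.
exact: closed_subspaceB.
Qed.

Lemma reducesP {L : set H} : reduces dot setT T L <->
  [/\ closed_subspace L, forall x, L x -> L (T x)
    & forall x, L x -> L (adj T x)].
Proof. by split=> -[]. Qed.

Lemma reduces_bigI {I} (D : set I) (L : I -> set H) :
  (forall i, D i -> reduces dot setT T (L i)) ->
  reduces dot setT T (\bigcap_(i in D) L i).
Proof.
move=> LT; apply/reducesP; split.
- by apply: closed_subspace_bigI => i /LT[].
- by move=> x xL i Di; have [_ _ + _] := LT i Di; apply; exact: xL.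
- by move=> x xL i Di; have [_ _ _] := LT i Di; apply; exact: xL.
Qed.

Lemma reducesI {K L : set H} : reduces dot setT T K -> reduces dot setT T L ->
  reduces dot setT T (K `&` L).
Proof.
by move=> KT LT; rewrite -bigcap2E; apply: reduces_bigI => -[|[|]].
Qed.

Lemma reduces_trans {K L : set H} : reduces dot setT T K ->
  reduces dot K T L -> reduces dot setT T L.
Proof.
move=> /reducesP[Kcl KT KT'] [Lcl LK LT LT']; apply/reducesP; split=> // x Lx.
rewrite -(adjoint_onE _ Kcl); [exact: LT'|exact: LK|exact/KT'/LK].
Qed.

(** * The largest subspace reducing a contraction to an isometry *)

Definition word (w : seq bool) (x : H) :=
  foldr (fun b y => if b then T y else adj T y) x w.

Lemma word_linear w a x y : word w (a *: x + y) = a *: word w x + word w y.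
Proof.
by elim: w => //= b w ->; case: b; rewrite ?linearP ?adjoint_linear.
Qed.

Lemma wordB w x y : word w (x - y) = word w x - word w y.
Proof. by rewrite addrC -scaleN1r word_linear scaleN1r addrC. Qed.

Lemma word_contraction w x : `|word w x| <= `|x|.
Proof.
elim: w => //= b w; apply: le_trans.
by case: b; [exact: Tc|exact: adjoint_contraction].
Qed.

Lemma word_rcons w b x :
  word (rcons w b) x = word w (if b then T x else adj T x).
Proof. by rewrite /word foldr_rcons. Qed.

Definition isometric_part : set H :=
  [set x | forall w, adj T (T (word w x)) = word w x].

Lemma isometric_part_closed : closed_subspace isometric_part.
Proof.
split.
- move=> w; have -> : word w 0 = 0.
    by apply/eqP; rewrite -normr_le0 (le_trans (word_contraction _ _))// normr0.
  by apply: isometric_adjointK; rewrite linear0.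
- move=> a x y xP yP w.
  by rewrite word_linear linearP adjoint_linear xP yP.
(* [isometric_part] is the intersection of the kernels of the maps [f w], each of which is
   2-Lipschitz. *)
pose f w x := adj T (T (word w x)) - word w x.
rewrite (_ : isometric_part = \bigcap_(w in setT) (f w @^-1` [set 0])); last first.
  apply/seteqP; split=> [x xP w _|x xP w]; first by rewrite /f/= xP subrr.
  by apply/eqP; rewrite -subr_eq0; apply/eqP; exact: xP.
apply: closed_bigI => w _; apply: (closed_lipschitz_preimage _ 2) => //.
  move=> x y; rewrite (_ : f w x - f w y = f w (x - y)); last first.
    by rewrite /f wordB (linearB T) adjointB !opprD !opprK addrACA.
  have wxy := word_contraction w (x - y).
  rewrite (le_trans (ler_normB _ _))// mulr2n mulrDl mul1r lerD//.
  exact: le_trans (adjoint_contraction _) (le_trans (Tc _ I) wxy).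
exact/accessible_closed_set1/hausdorff_accessible/norm_hausdorff.
Qed.

Lemma isometric_part_reduces : reduces dot setT T isometric_part.
Proof.
apply/reducesP; split; first exact: isometric_part_closed.
  by move=> x xP w; have := xP (rcons w true); rewrite word_rcons.
by move=> x xP w; have := xP (rcons w false); rewrite word_rcons.
Qed.

Lemma isometry_isometric_part : isometry_on isometric_part T.
Proof.
move=> x /(_ [::])/= Tx; apply/eqP.
by rewrite -(@eqrXn2 _ 2)// -!Hdot adjointE Tx.
Qed.

Lemma sub_isometric_part (L : set H) : reduces dot setT T L ->
  isometry_on L T -> L `<=` isometric_part.
Proof.
move=> /reducesP[_ LT LT'] Liso x Lx w; apply/isometric_adjointK/Liso.
by elim: w => //= -[] w; [exact: LT|exact: LT'].
Qed.

Lemma isometric_part_commute (f : H -> H) x :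
  (forall y, f (T y) = T (f y)) -> (forall y, f (adj T y) = adj T (f y)) ->
  isometric_part x -> isometric_part (f x).
Proof.
move=> fT fT' xP w; have fw : word w (f x) = f (word w x).
  by elim: w => //= -[] w ->; rewrite ?fT ?fT'.
by rewrite fw -fT -fT' xP.
Qed.

Lemma orthocomp_reduces (M : set H) : reduces dot setT T M ->
  reduces dot setT T (orthocomp M).
Proof.
move=> /reducesP[Mcl MT MT']; apply/reducesP.
split=> [|x xM z Mz|x xM z Mz]; first exact: orthocomp_closed.
  by rewrite adjointE xM//; exact: MT'.
by rewrite adjointEr xM//; exact: MT.
Qed.

Lemma proj_reducing (M : set H) x : reduces dot setT T M ->
  proj M (T x) = T (proj M x) /\ proj M (adj T x) = adj T (proj M x).
Proof.
move=> /reducesP[Mcl MT MT']; split.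
  by apply: (proj_commute Mcl _ (adj T)) => //;
    [exact: linearB|exact: adjointE].
by apply: (proj_commute Mcl _ T) => //; [exact: adjointB|exact: adjointEr].
Qed.

(** * Wold decomposition of the isometry [T] on [M] *)

Section Wold.
Context {M : set H} (MT : reduces dot setT T M) (Tiso : isometry_on M T).

Let Mcl : closed_subspace M.
Proof. by case: MT. Qed.

Let MTx x : M x -> M (T x).
Proof. by case: MT => _ _ + _; apply. Qed.

Let MTx' x : M x -> M (adj T x).
Proof. by case: MT => _ _ _; apply. Qed.

Let TK x : M x -> adj T (T x) = x.
Proof. by move=> Mx; exact/isometric_adjointK/Tiso. Qed.

Let iter_adj_linear k a x y :
  iter k (adj T) (a *: x + y) = a *: iter k (adj T) x + iter k (adj T) y.
Proof. by elim: k => //= k ->; rewrite adjoint_linear. Qed.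

Let iter_adj_contraction k x : `|iter k (adj T) x| <= `|x|.
Proof. by elim: k => //= k; apply: le_trans; exact: adjoint_contraction. Qed.

Let iter_adj_mem k x : M x -> M (iter k (adj T) x).
Proof. by move=> Mx; elim: k => //= k; exact: MTx'. Qed.

(** The shift summand of the Wold decomposition; complete non-unitarity will make it all of [M]. *)
Definition pure_part :=
  [set x | M x /\ iter m (adj T) x @[m --> \oo] --> (0 : H)].

Lemma pure_part_closed : closed_subspace pure_part.
Proof.
have [M0 MP Mclosed] := Mcl; split.
- split=> //; rewrite (_ : (fun m => _) = cst 0); first exact: cvg_cst.
  apply/funext => m; apply/eqP; rewrite -normr_le0.
  by rewrite (le_trans (iter_adj_contraction m 0))// normr0.
- move=> a x y [Mx x0] [My y0]; split; first exact: MP.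
  under eq_fun do rewrite iter_adj_linear.
  have -> : (0 : H) = a *: 0 + 0 by rewrite scaler0 addr0.
  by apply: cvgD => //; exact: cvgZr.
apply: closedP_dist => x xP; split.
  apply: closed_dist => // e /xP[y [My _] xy]; by exists y.
(* The powers of [adj T] are contractions, so replacing [x] by [y] costs less than [e / 2] uniformly
   in [m]. *)
apply/cvgrPdist_lt => e e0; have e2 : 0 < e / 2 by rewrite divr_gt0.
have [y [My /cvgrPdist_lt/(_ _ e2)y0] xy] := xP _ e2.
apply: filterS y0 => m; rewrite !sub0r !normrN => ym.
rewrite -[x](subrK y) -[x - y]scale1r iter_adj_linear scale1r.
rewrite (le_lt_trans (ler_normD _ _))// [ltRHS]splitr.
by rewrite ltrD// (le_lt_trans (iter_adj_contraction _ _)).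
Qed.

Lemma pure_part_reduces : reduces dot setT T pure_part.
Proof.
apply/reducesP; split=> [|x [Mx x0]|x [Mx x0]]; first exact: pure_part_closed.
  (* Since [adj T (T x) = x] on [M], the orbit of [T x] shifted by one is the orbit of [x]. *)
  split; [exact: MTx|rewrite -cvg_shiftS].
  rewrite -(eq_cvg _ _ (f := fun m => iter m (adj T) x))// => m /=.
  by rewrite -iterS iterSr TK.
split; [exact: MTx'|rewrite -cvg_shiftS in x0].
rewrite -(eq_cvg _ _ (f := fun m => iter m.+1 (adj T) x))// => m.
by rewrite -iterSr.
Qed.

(* For x orthogonal to pure_part, d = x - T T^* x lies in pure_part, because
   T^* d = 0, and <d, x> = <d, d>. *)
Lemma pure_part_orthocomp_range x :
  M x -> orthocomp pure_part x -> T (adj T x) = x.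
Proof.
move=> Mx xP; pose d := x - T (adj T x).
have Md : M d by apply: closed_subspaceB => //; exact/MTx/MTx'.
have d0 : adj T d = 0 by rewrite adjointB TK ?subrr//; exact: MTx'.
have /xP/dot0C : pure_part d.
  split=> //; rewrite -cvg_shiftS; have [[_ c0] _ _] := pure_part_closed.
  rewrite -(eq_cvg _ _ (f := fun m => iter m (adj T) 0))// => m /=.
  by rewrite -iterS iterSr d0.
have -> : dot d x = dot d d.
  by rewrite {3}/d dotBr -adjointEr d0 dot0l subr0.
by move/eqP; rewrite dnorm_eq0 subr_eq0 eq_sym => /eqP.
Qed.

Lemma wold_pure : cnu_contraction_on dot setT T -> pure_isometry_on dot M T.
Proof.
move=> [_ cnu]; split=> // h Mh.
have hM k : iter k (adjoint_on dot M T) h = iter k (adj T) h.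
  by elim: k => //= k ->; rewrite adjoint_onE//;
    [exact: iter_adj_mem|exact/MTx'/iter_adj_mem].
under eq_fun do rewrite hM.
suff : pure_part h by case.
have UT := reducesI MT (orthocomp_reduces _ pure_part_reduces).
(* On this reducing subspace [T] is isometric, and onto by [pure_part_orthocomp_range], hence
   unitary. *)
have U0 : M `&` orthocomp pure_part = [set 0].
  apply: (cnu _ UT); split=> [x [Mx _]|]; first exact: Tiso.
  have /reducesP[_ UTx UTx'] := UT.
  apply/seteqP; split=> [_ [x xU <-]|x xU]; first exact: UTx.
  exists (adj T x); first exact: UTx'.
  by case: xU; exact: pure_part_orthocomp_range.
have Pcl := pure_part_closed.
have [Mp _] := proj_mem Pcl h.
have : (M `&` orthocomp pure_part) (h - proj pure_part h).
  by split; [exact: closed_subspaceB|exact: proj_orthocomp].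
rewrite U0 => /eqP; rewrite subr_eq0 => /eqP ->; exact: proj_mem.
Qed.

End Wold.

End Adjoint.

(** * Decomposition along binary digits and the doubly commuting family *)

Lemma sum_bits_ex n (P : 'I_n -> bool -> set H) :
  (forall i x, exists y : bool -> H, x = y false + y true /\
     forall b, P i b (y b) /\ forall i' b', P i' b' x -> P i' b' (y b)) ->
  forall x, exists y : 'I_(2 ^ n) -> H,
    (forall (j : 'I_(2 ^ n)) i, P i (bit i j) (y j)) /\ x = \sum_(j < 2 ^ n) y j.
Proof.
move=> splitP x.
(* The family is indexed by [nat] so that its range can double at each stage [k] of the
   induction. *)
suff step k : (k <= n)%N -> exists y : nat -> H,
    (forall j, (j < 2 ^ k)%N ->
       forall i : 'I_n, (i < k)%N -> P i (bit i j) (y j)) /\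
    x = \sum_(0 <= j < 2 ^ k) y j.
  have [y [yP ->]] := step n (leqnn n).
  by exists y; split=> [j i|]; [exact: yP|rewrite big_mkord].
elim: k => [|k IH] kn; first by exists (fun=> x); rewrite big_nat1.
have [y [yP xy]] := IH (ltnW kn).
have /choice[f fP] := splitP (Ordinal kn).
(* The piece of index [j %% 2 ^ k] is split in two, and digit [k] of [j] selects the half. Each half
   inherits the properties already obtained for smaller digits. *)
exists (fun j => f (y (j %% 2 ^ k)%N) (bit k j)); split.
  move=> j jk i ik; have [_ /(_ (bit k j))[fj fjP]] := fP (y (j %% 2 ^ k)%N).
  move: ik; rewrite ltnS leq_eqVlt => /predU1P[ik|ik].
    have -> : i = Ordinal kn by exact: val_inj.
    exact: fj.
  apply: fjP; rewrite (_ : bit i j = bit i (j %% 2 ^ k)%N).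
    by apply: yP => //; rewrite ltn_mod expn_gt0.
  have [jlt|jge] := ltnP j (2 ^ k); first by rewrite modn_small.
  move: jk; rewrite -(subnKC jge) expnS mul2n -addnn ltn_add2l => jlt.
  by rewrite modnDl modn_small// bit_pow2D.
rewrite expnS mul2n -addnn (big_cat_nat _ (n := 2 ^ k))//= ?leq_addr//.
rewrite -[X in _ + \sum_(X <= _ < _) _]add0n big_addn addnK -big_split xy.
(* The terms [j] and [2 ^ k + j] are the two halves of [y j]. *)
apply: eq_big_nat => j /= jk.
rewrite modn_small// bit_diag// addnC modnDl modn_small// bit_pow2D_diag//.
by have [] := fP (y j).
Qed.

Section DoublyCommuting.
Context {n : nat} {T : 'I_n -> {linear H -> H}}.
Context (Tc : forall i, contraction_on setT (T i)).
Context (Tdc : doubly_commuting dot T).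

Definition component (i : 'I_n) (b : bool) : set H :=
  if b then orthocomp (isometric_part (T := T i))
  else isometric_part (T := T i).

Lemma isometric_part_joint_reducing i k :
  reduces dot setT (T k) (isometric_part (T := T i)).
Proof.
have [<-|ik] := eqVneq i k; first exact: isometric_part_reduces.
have [TT TT'] := Tdc; have ki : k != i by rewrite eq_sym.
apply/reducesP; split; first exact: isometric_part_closed.
- move=> x; apply: isometric_part_commute => y; first exact: TT.
  exact: TT'.
- move=> x; apply: isometric_part_commute => y; first by rewrite -TT'.
  (* The two adjoints commute because [T i] and [T k] do, as seen by moving both across the inner
     product. *)
  apply: dot_injr => z.
  by rewrite -!(adjointE (Tc _)) TT.
Qed.

Lemma component_reduces i b k : reduces dot setT (T k) (component i b).
Proof.
case: b; last exact: isometric_part_joint_reducing.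
exact/orthocomp_reduces/isometric_part_joint_reducing.
Qed.

Lemma component_closed i b : closed_subspace (component i b).
Proof. by have [] := component_reduces i b i. Qed.

(** The projection commutes with [T k] and its adjoint, so it preserves the isometric part of [T k];
    being self-adjoint, it also preserves the complement. *)
Lemma proj_isometric_part i k b x : component k b x ->
  component k b (proj (isometric_part (T := T i)) x).
Proof.
have Mk y : isometric_part (T := T k) y ->
    isometric_part (T := T k) (proj (isometric_part (T := T i)) y).
  have MT z := proj_reducing (Tc k) _ z (isometric_part_joint_reducing i k).
  by apply: isometric_part_commute => z; have [] := MT z.
case: b => [xM z /Mk zM|]; last exact: Mk.
by rewrite (dot_proj (component_closed i false)) xM.
Qed.

Lemma component_split i x : exists y : bool -> H, x = y false + y true /\
  forall b, component i b (y b) /\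
    forall k c, component k c x -> component k c (y b).
Proof.
have Mcl := component_closed i false; set p := proj (component i false) x.
exists (fun b => if b then x - p else p); split; first by rewrite addrC subrK.
case; split=> [|k c xk].
- exact: proj_orthocomp.
- apply: closed_subspaceB; [exact: component_closed|by []|].
  exact: proj_isometric_part.
- exact: proj_mem.
- exact: proj_isometric_part.
Qed.

(** Digit [i] of [j] encodes the type of [T i]: false for [B1], true for [B2]. Index 0 is thus all
    [B1], and [2 ^ n - 1] all [B2]. *)
Definition cell (j : nat) : set H :=
  \bigcap_(i in [set: 'I_n]) component i (bit i j).

Lemma cell_reduces j k : reduces dot setT (T k) (cell j).
Proof. by apply: reduces_bigI => i _; exact: component_reduces. Qed.

Lemma cell_orthogonal_sum : orthogonal_sum dot (fun j : 'I_(2 ^ n) => cell j).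
Proof.
split=> [j|j k jk x y xj yk|x].
- by apply: closed_subspace_bigI => i _; exact: component_closed.
- have [i ijk] : exists i : 'I_n, bit i j != bit i k.
    apply/existsP; apply: contra_neqT jk => /existsPn/= jk.
    by apply: ord_bit_inj => i; have /negPn/eqP := jk i.
  move: ijk (xj i I) (yk i I); case: (bit i j); case: (bit i k) => // _ xi yi.
    exact: xi.
  exact/dot0C/yi.
- have [y [yP xy]] := sum_bits_ex _ _ component_split x.
  by exists y; split => // j i _; exact: yP.
Qed.

Context (Tcnu : forall i, cnu_contraction_on dot setT (T i)).

Lemma cell_pure j (i : 'I_n) : ~~ bit i j -> pure_isometry_on dot (cell j) (T i).
Proof.
move=> /negbTE ij; apply: wold_pure => //; first exact: cell_reduces.
by move=> x /(_ i I); rewrite ij; exact: isometry_isometric_part.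
Qed.

Lemma cell_cni j (i : 'I_n) : bit i j -> cni_contraction_on dot (cell j) (T i).
Proof.
move=> ij; split=> [x _|L Lred Liso]; first exact: Tc.
(* Being reducing in the whole space and isometric for [T i], [L] lies in the isometric part, while
   the cell lies in its complement. *)
have LT := reduces_trans (Tc i) (cell_reduces j i) Lred.
have [L0 _ _] : closed_subspace L by case: Lred.
apply/seteqP; split=> [x Lx|_ ->//].
apply: (orthocomp_eq0 (isometric_part (T := T i))).
  exact: sub_isometric_part Lx.
by have [_ + _ _] := Lred => /(_ _ Lx)/(_ i I); rewrite ij.
Qed.

(** Projection onto [K] commutes with [T i] and its adjoint, so it sends the isometric part into its
    intersection with [K]. That intersection reduces [T i] to an isometry, hence is zero, which
    makes the isometric part orthogonal to [K]. *)
Lemma cni_sub_orthocomp i (K : set H) : reduces dot setT (T i) K ->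
  cni_contraction_on dot K (T i) -> K `<=` orthocomp (isometric_part (T := T i)).
Proof.
move=> KT [_ cni] x Kx z zM; have [Kcl KTx KTx'] := (reducesP.1 KT).
pose L := K `&` isometric_part (T := T i).
have /reducesP[Lcl LT LT'] : reduces dot setT (T i) L.
  by apply: reducesI => //; exact: isometric_part_reduces.
have L0 : L = [set 0].
  apply: cni; last by move=> y [_ yM]; exact: isometry_isometric_part.
  split=> //; first by move=> y [].
  move=> y Ly; have [Ky _] := Ly; rewrite adjoint_onE//; first exact: LT'.
  exact: KTx'.
have : L (proj K z).
  split; first exact: proj_mem.
  have zT y := proj_reducing (Tc i) _ y KT.
  by apply: isometric_part_commute zM => y; have [] := zT y.
rewrite L0 => /= z0; apply: dot0C.
by have := proj_orthocomp Kcl z x Kx; rewrite z0 subr0.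
Qed.

End DoublyCommuting.

End Hilbert.

Theorem theorem5p4 (R : realType) (H : completeNormedModType R[i])
    (dot : {dot H for Num.conj}) (Hdot : hilbert dot)
    (n : nat) (T : 'I_n -> {linear H -> H})
    (Tcnu : forall i, cnu_contraction_on dot setT (T i))
    (Tdc : doubly_commuting dot T) :
  exists (Hs : 'I_(2 ^ n) -> set H) (ty : 'I_(2 ^ n) -> 'I_n -> btype),
    orthogonal_sum dot Hs /\
    (* (1) *)
    (forall j, joint_reducing dot T (Hs j)) /\
    (* (2) *)
    (forall i j, pure_isometry_on dot (Hs j) (T i) \/
                 cni_contraction_on dot (Hs j) (T i)) /\
    (* (3): ty j is the list of types assigned to the j-th element of F_n *)
    (forall j k, of_type dot (ty j k) (Hs j) (T k)) /\
    (forall g : 'I_n -> btype, exists! j, forall k, ty j k = g k) /\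
    (* (4) *)
    maximal_joint_reducing dot T (pure_isometry_on dot) (Hs (first_index n)) /\
    (* (5) *)
    maximal_joint_reducing dot T (cni_contraction_on dot) (Hs (last_index n)).
Proof.
have Tc i : contraction_on setT (T i) by case: (Tcnu i).
pose ty (j : 'I_(2 ^ n)) (i : 'I_n) := if bit i j then B2 else B1.
have tyP (j : 'I_(2 ^ n)) i : of_type dot (ty j i) (cell (dot := dot) (T := T) j) (T i).
  rewrite /ty; case: ifPn => ij; first exact: cell_cni.
  exact: cell_pure.
have red (j : 'I_(2 ^ n)) : joint_reducing dot T (cell (dot := dot) (T := T) j).
  split; last by move=> i; exact: cell_reduces.
  by have [] := cell_orthogonal_sum Hdot Tc Tdc.
exists (fun j => cell (dot := dot) (T := T) j), ty; split.
  exact: cell_orthogonal_sum.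
split=> //; split.
  move=> i j; have := tyP j i; rewrite /ty.
  by case: ifP => _ ijP; [right|left].
split=> //; split.
  move=> g; have [j jg] := bit_surj n (fun i => if g i is B2 then true else false).
  exists j; split=> [i|k kg]; first by rewrite /ty jg; case: (g i).
  (* Uniqueness concerns the assigned lists: they determine all digits of the index, even if some
     cells are zero. *)
  by apply: ord_bit_inj => i; rewrite jg -kg /ty; case: (bit i k).
split; split=> //.
- by move=> i; apply: cell_pure => //; rewrite bit0n.
(* Maximality: [K] lies in the isometric part of every [T i], and index 0 selects exactly these. *)
- move=> K [_ KT] Kpure x Kx i _; rewrite bit0n.
  by apply: sub_isometric_part Kx => //; have [] := Kpure i.
- by move=> i; apply: cell_cni => //; exact: bit_pow2_pred.
- move=> K [_ KT] Kcni x Kx i _; rewrite bit_pow2_pred//.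
  exact: (cni_sub_orthocomp _ _ _ _ (KT i)).
Qed.
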